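(* Let $f_1,\dots,f_m:\mathbb{R}^n\to\mathbb{R}$ be convex functions, let $I=\{1,\dots,m\}$, and let $X\subseteq\mathbb{R}^n$ be a compact convex set. Consider the convex vector optimization problem (CVOP) of minimizing $f(x)=(f_1(x),\dots,f_m(x))$ over $x\in X$, and the algorithm CC1 for it, started at a point $x_0\in X$. Then: (1) The iterates of the algorithm CC1 are well-defined; that is, for every iterate $x_k$ that is generated, the solution set $\mathrm{Sol}(P_k)$ of the subproblem $P_k$ is non-empty. (2) If $\{x_k\}$ is a sequence generated by the algorithm CC1, then any limit point of $\{x_k\}$ is a Pareto minimizer of CVOP.
   Context: Pareto minimizer: a point $x^*\in X$ is a Pareto minimizer of CVOP if there is no $x\in X$ with $f_i(x)\le f_i(x^* )$ for all $i\in I$ and $f_r(x)<f_r(x^* )$ for some $r\in I$. Algorithm CC1. Step 1: choose $x_0\in X$ and set $k:=0$. Step 2: given $x_k\in X$, let $P_k$ be the scalar problem $$\min \sum_{i\in I} f_i(x)\quad\text{subject to}\quad x\in X_k:=\{x\in X: f_i(x)\le f_i(x_k)\ \text{for all } i\in I\},$$ with solution set (set of global minimizers) $\mathrm{Sol}(P_k)$. Take some $y_k\in\mathrm{Sol}(P_k)$ (an arbitrary choice). If $y_k=x_k$, stop. Otherwise set $x_{k+1}:=y_k$, $k:=k+1$, and repeat Step 2. Thus an infinite sequence $\{x_k\}_{k\ge 0}$ generated by CC1 satisfies $x_0\in X$ and, for every $k\ge 0$, $x_{k+1}\in\mathrm{Sol}(P_k)$ and $x_{k+1}\neq x_k$.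 A limit point of a sequence means the limit of some subsequence. *)

(* Defs.v *)
From HB Require Import structures.
From mathcomp Require Export all_boot all_order all_algebra.
From mathcomp Require Export all_classical all_reals all_analysis.

Set Implicit Arguments.
Unset Strict Implicit.
Unset Printing Implicit Defensive.

Import Order.TTheory GRing.Theory Num.Theory.
Import numFieldNormedType.Exports.

Local Open Scope classical_set_scope.
Local Open Scope ring_scope.

Definition global_minimizers (R : realType) (T : Type) (S : set T)
    (g : T -> R) : set T :=
  [set y | S y /\ forall z, S z -> g y <= g z].

Definition pareto_minimizer (R : realType) (m n : nat)
    (f : 'I_m -> 'rV[R]_n -> R) (X : set 'rV[R]_n) (xs : 'rV[R]_n) : Prop :=
  X xs /\
  ~ exists x, [/\ X x, forall i, f i x <= f i xs & exists r, f r x < f r xs].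

Definition CC1_feasible (R : realType) (m n : nat)
    (f : 'I_m -> 'rV[R]_n -> R) (X : set 'rV[R]_n) (xk : 'rV[R]_n) :
    set 'rV[R]_n :=
  [set x | X x /\ forall i, f i x <= f i xk].

Definition CC1_Sol (R : realType) (m n : nat)
    (f : 'I_m -> 'rV[R]_n -> R) (X : set 'rV[R]_n) (xk : 'rV[R]_n) :
    set 'rV[R]_n :=
  global_minimizers (CC1_feasible f X xk) (fun x => \sum_(i < m) f i x).

Definition CC1_step (R : realType) (m n : nat)
    (f : 'I_m -> 'rV[R]_n -> R) (X : set 'rV[R]_n) (xk y : 'rV[R]_n) : Prop :=
  CC1_Sol f X xk y /\ y <> xk.

(* Only [x 0], ..., [x N] matter here: they are the iterates of a (possibly
   partial) execution; the values of [x] beyond [N] are junk. *)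
Definition CC1_run (R : realType) (m n : nat)
    (f : 'I_m -> 'rV[R]_n -> R) (X : set 'rV[R]_n) (x0 : 'rV[R]_n)
    (N : nat) (x : nat -> 'rV[R]_n) : Prop :=
  x 0%N = x0 /\ forall k, (k < N)%N -> CC1_step f X (x k) (x k.+1).

(* An execution that stops has finitely many iterates, hence no subsequence
   and no limit point; only infinite executions are sequences here. *)
Definition CC1_sequence (R : realType) (m n : nat)
    (f : 'I_m -> 'rV[R]_n -> R) (X : set 'rV[R]_n) (x0 : 'rV[R]_n)
    (x : nat -> 'rV[R]_n) : Prop :=
  x 0%N = x0 /\ forall k, CC1_step f X (x k) (x k.+1).

(* Not [limit_point] of the range of [x]: a value taken infinitely often
   counts. *)
Definition subsequential_limit (T : topologicalType) (x : nat -> T)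
    (p : T) : Prop :=
  exists phi : nat -> nat,
    {homo phi : i j / (i < j)%N} /\ (fun k => x (phi k)) @ \oo --> p.

(* Main.v *)
(** Along the algorithm the objective values never increase, so every iterate
    after the first lies in the sublevel set [X_1] of [x_1], and so does every
    limit point [p], since [X_1] is closed.  A point dominating [p] would belong
    to [X_1], hence to [X_0], with a strictly smaller sum of objectives than
    [x_1], although [x_1] minimizes this sum over [X_0].  Compactness of the
    sublevel sets and existence of minimizers come from the continuity of finite
    convex functions on [R^n]. *)
Require Import Defs.
From mathcomp Require Import all_boot all_order all_algebra.
From mathcomp Require Import all_classical all_reals all_analysis.
From mathcomp Require Import ring lra.
Set Implicit Arguments.
Unset Strict Implicit.
Unset Printing Implicit Defensive.

Import Order.TTheory GRing.Theory Num.Theory.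
Import numFieldNormedType.Exports.

Local Open Scope classical_set_scope.
Local Open Scope ring_scope.

Lemma convex_functionT_le (R : realType) (E : lmodType R) (f : E -> R) :
  convex_function [set: E] f ->
  forall (t : R) (x y : E), 0 <= t -> t <= 1 ->
    f (t *: x + (1 - t) *: y) <= t * f x + (1 - t) * f y.
Proof.
move=> fconv t x y t0 t1.
by apply: (fconv (Itv01 t0 t1) x y); rewrite inE.
Qed.

(** Every point of the segment is a convex combination of its endpoints; the absolute values allow
    both weights to be replaced by 1. *)
Lemma convex_bounded_segment (R : realType) (E : lmodType R) (f : E -> R)
    (p w : E) (C : R) :
  convex_function [set: E] f -> 0 < C ->
  forall t, `|t| <= C -> f (p + t *: w) <= `|f (p + C *: w)| + `|f (p - C *: w)|.
Proof.
move=> /convex_functionT_le fconv C0 t; rewrite ler_norml => /andP[tl tr].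
(* The weight of the endpoint [p + C *: w], solving [t = s * C - (1 - s) * C]. *)
pose s := (t + C) / (2 * C).
have sE : s * (2 * C) = t + C by rewrite /s; field; lra.
have s0 : 0 <= s by rewrite divr_ge0//; lra.
have s1 : s <= 1 by rewrite /s ler_pdivrMr; lra.
have -> : p + t *: w = s *: (p + C *: w) + (1 - s) *: (p - C *: w).
  rewrite !scalerDr scalerN !scalerA -scaleNr addrACA -!scalerDl.
  rewrite (_ : s + (1 - s) = 1) ?scale1r; last lra.
  by congr (_ + _ *: _); rewrite -[t](addrK C) -sE; ring.
apply: le_trans (fconv _ _ _ s0 s1) _; apply: lerD.
- apply: (le_trans (ler_wpM2l s0 (ler_norm _))).
  by rewrite ler_piMl.
- apply: (le_trans (ler_wpM2l _ (ler_norm _))); first lra.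
  by rewrite ler_piMl//; lra.
Qed.

(** Induction on [s]: a point of the box is the midpoint of one displaced along [e j] only and one
    displaced along the remaining directions. Both displacements are doubled, so the induction
    hypothesis is taken at [2 * C]. *)
Lemma convex_bounded_box (R : realType) (E : lmodType R) (I : Type)
    (f : E -> R) (p : E) (e : I -> E) (s : seq I) (C : R) :
  convex_function [set: E] f -> 0 < C ->
  exists M, forall c : I -> R, (forall j, `|c j| <= C) ->
    f (p + \sum_(j <- s) c j *: e j) <= M.
Proof.
move=> fconv; elim: s C => [|j s IH] C C0.
  by exists (f p) => c _; rewrite big_nil addr0.
have C20 : 0 < 2 * C by lra.
have [M HM] := IH _ C20.
set N := `|f (p + (2 * C) *: e j)| + `|f (p - (2 * C) *: e j)|.
exists (2^-1 * N + (1 - 2^-1) * M) => c cC; rewrite big_cons.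
have c2 i : `|2 * c i| <= 2 * C by rewrite normrM ger0_norm// ler_pM2l.
have -> : p + (c j *: e j + \sum_(i <- s) c i *: e i) =
    2^-1 *: (p + (2 * c j) *: e j)
    + (1 - 2^-1) *: (p + \sum_(i <- s) (2 * c i) *: e i).
  under [X in _ = _ + _ *: (_ + X)]eq_bigr do rewrite -scalerA.
  rewrite -scaler_sumr !scalerDr !scalerA addrACA -scalerDl.
  rewrite mulrA mulVf ?pnatr_eq0// mul1r.
  rewrite (_ : (1 - 2^-1) * 2 = 1 :> R) ?scale1r; last lra.
  by rewrite (_ : 2^-1 + (1 - 2^-1) = 1 :> R) ?scale1r//; lra.
have h0 : 0 <= 2^-1 :> R by lra.
have h1 : 2^-1 <= 1 :> R by lra.
apply: le_trans (convex_functionT_le fconv _ _ h0 h1) _.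
apply: lerD; apply: ler_wpM2l => //; first exact: convex_bounded_segment.
  by rewrite subr_ge0.
exact: HM.
Qed.

Lemma mx_norm_coord_le (R : realType) (m n : nat) (v : 'M[R]_(m, n)) i j :
  `|v i j| <= `|v|.
Proof.
rewrite [leRHS]mx_normrE.
exact: (le_bigmax _ (fun ij : 'I_m * 'I_n => `|v ij.1 ij.2|) (i, j)).
Qed.

(** The norm is the largest absolute value of a coordinate, so the unit ball is contained in the box
    on the standard basis with [C = 1]. *)
Lemma convex_bounded_ball (R : realType) (n : nat) (f : 'rV[R]_n -> R)
    (p : 'rV[R]_n) :
  convex_function [set: 'rV[R]_n] f ->
  exists M, forall v, `|v| <= 1 -> f (p + v) <= M.
Proof.
move=> fconv.
have [M HM] := convex_bounded_box p (fun j => delta_mx 0 j)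
  (index_enum 'I_n) fconv ltr01.
exists M => v v1; rewrite [v]row_sum_delta; apply: HM => j.
exact: le_trans (mx_norm_coord_le v 0 j) v1.
Qed.

(** An upper bound suffices: convexity on a line through [p] turns it into a bound on both the
    increase and the decrease of [f] near [p]. *)
Lemma convex_bounded_continuous_at (R : realType) (E : normedModType R)
    (f : E -> R) (p : E) (M : R) :
  convex_function [set: E] f -> (forall v, `|v| <= 1 -> f (p + v) <= M) ->
  {for p, continuous f}.
Proof.
move=> /convex_functionT_le fconv fM; apply/cvgrPdist_le => /= e e0.
have fpM : f p <= M by rewrite -[p]addr0 fM// normr0.
(* The summand 1 keeps [K] positive when [M = f p]. *)
set K := M - f p + 1.
have K0 : 0 < K by rewrite /K; lra.
pose t := Num.min 1 (e / K).
have t0 : 0 < t by rewrite lt_min ltr01 divr_gt0.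
have t1 : t <= 1 by rewrite ge_min lexx.
have tK : t * K <= e by rewrite -ler_pdivlMr// ge_min lexx orbT.
have tM : t * (M - f p) <= e.
  by apply: le_trans tK; rewrite ler_pM2l// /K; lra.
near=> y.
have yt : `|y - p| <= t.
  by rewrite distrC; near: y; exact: cvgr_dist_le.
(* The displacement is stretched until it just fits in the unit ball, so that [y = p + t *: w]. *)
set w := t^-1 *: (y - p).
have w1 : `|w| <= 1.
  by rewrite normrZ gtr0_norm ?invr_gt0// mulrC ler_pdivrMr// mul1r.
have ww : t *: w = y - p by rewrite scalerA divff ?scale1r// gt_eqF.
have upper : f y <= t * f (p + w) + (1 - t) * f p.
  rewrite (_ : y = t *: (p + w) + (1 - t) *: p); last first.
    by rewrite scalerDr ww addrAC -scalerDl addrC subrKC scale1r subrK.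
  by apply: fconv => //; exact: ltW.
(* [p] lies between [y] and the reflected point [p - w]. *)
have lower : (1 + t) * f p <= f y + t * f (p - w).
  pose s := (1 + t)^-1.
  have s0 : 0 <= s by rewrite invr_ge0; lra.
  have s1 : s <= 1 by rewrite invf_le1; lra.
  have sE : (1 + t) * s = 1 by rewrite divff//; lra.
  have sN : 1 - s = s * t by rewrite -sE; ring.
  have := fconv s y (p - w) s0 s1.
  have -> : s *: y + (1 - s) *: (p - w) = p.
    rewrite sN -scalerA -scalerDr scalerBr ww opprB addrCA subrKC.
    by rewrite -[X in _ + X]scale1r -scalerDl scalerA addrC mulrC sE scale1r.
  rewrite sN => /(ler_wpM2l (ltW (addr_gt0 ltr01 t0))) /le_trans; apply.
  by rewrite mulrDr !mulrA sE !mul1r.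
have fw := fM _ w1.
have fNw : f (p - w) <= M by apply: fM; rewrite normrN.
(* Both [f y - f p] and [f p - f y] are at most [t * (M - f p)]. *)
rewrite ler_distl; nra.
Unshelve. all: by end_near.
Qed.

Lemma convex_continuous (R : realType) (n : nat) (f : 'rV[R]_n -> R) :
  convex_function [set: 'rV[R]_n] f -> continuous f.
Proof.
move=> fconv p; have [M HM] := convex_bounded_ball p fconv.
exact: convex_bounded_continuous_at HM.
Qed.

Section CC1.
Context {R : realType} {m n : nat}.
Variables (f : 'I_m -> 'rV[R]_n -> R) (X : set 'rV[R]_n).

Lemma CC1_feasible_compact (x : 'rV[R]_n) :
  (forall i, continuous (f i)) -> compact X -> compact (CC1_feasible f X x).
Proof.
move=> fcont Xc.
have -> : CC1_feasible f X x =
    X `&` \bigcap_(i in [set: 'I_m]) (f i @^-1` [set z | z <= f i x]).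
  by apply/seteqP; split => y [Xy fy]; split => // i *; exact: fy.
apply: compact_closedI => //; apply: closed_bigI => i _.
by apply: preimage_closed => [y _|]; [exact: fcont|exact: closed_le].
Qed.

Lemma CC1_Sol_nonempty (x : 'rV[R]_n) :
  (forall i, continuous (f i)) -> compact X -> X x -> CC1_Sol f X x !=set0.
Proof.
move=> fcont Xc Xx.
have feas0 : CC1_feasible f X x !=set0 by exists x.
have sum_cont : continuous (fun y => \sum_(i < m) f i y).
  move=> y; apply: (cvg_big _ (nbhs_filter y)) => [|i _].
    exact: add_continuous.
  exact: fcont.
have [|y /set_mem feasy ymin] :=
    compact_EVT_min feas0 (CC1_feasible_compact fcont Xc)
      (f := fun y => \sum_(i < m) f i y).
  exact: continuous_subspaceT.
by exists y; split => // z feasz; apply: ymin; rewrite inE.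
Qed.

(** Makes the sublevel set of a fixed [z] an invariant of the algorithm. *)
Lemma CC1_step_feasible (z x y : 'rV[R]_n) :
  CC1_feasible f X z x -> CC1_step f X x y -> CC1_feasible f X z y.
Proof.
move=> [_ xz] [[[Xy yx] _] _]; split => // i.
exact: le_trans (yx i) (xz i).
Qed.

Lemma CC1_Sol_pareto (x y p : 'rV[R]_n) :
  CC1_Sol f X x y -> CC1_feasible f X y p -> pareto_minimizer f X p.
Proof.
move=> [[_ yx] ymin] [Xp py]; split => // -[z [Xz zp [r zpr]]].
have /ymin : CC1_feasible f X x z.
  by split=> // i; apply: le_trans (le_trans (zp i) (py i)) (yx i).
(* The term at [r] is split off: it decreases strictly, the others weakly. *)
apply/negP; rewrite -ltNge (bigD1 r)//= [ltRHS](bigD1 r)//=.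
apply: ltr_leD; first exact: lt_le_trans zpr (py r).
by apply: ler_sum => i _; exact: le_trans (zp i) (py i).
Qed.

End CC1.

Theorem theorem3p1 (R : realType) (m n : nat) (f : 'I_m -> 'rV[R]_n -> R)
    (X : set 'rV[R]_n) (x0 : 'rV[R]_n)
    (f_convex : forall i, convex_function [set: 'rV[R]_n] (f i))
    (X_compact : compact X) (X_convex : convex_set X) (x0_in_X : X x0) :
  (forall (N : nat) (x : nat -> 'rV[R]_n),
     CC1_run f X x0 N x -> CC1_Sol f X (x N) !=set0) /\
  (forall x : nat -> 'rV[R]_n, CC1_sequence f X x0 x ->
     forall p : 'rV[R]_n, subsequential_limit x p -> pareto_minimizer f X p).
Proof.
have f_cont i : continuous (f i) by exact: convex_continuous.
split=> [N x [x0E step]|x [x0E step] p [phi [phi_mono phi_p]]].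
  apply: CC1_Sol_nonempty => //.
  case: N step => [_|N step]; first by rewrite x0E.
  by have [[[]]] := step N (ltnSn N).
(* Indices start at 1, since [x 0] may lie outside this set. *)
have feas1 k : CC1_feasible f X (x 1) (x k.+1).
  elim: k => [|k IH]; last exact: CC1_step_feasible IH (step _).
  by have [[[]]] := step 0%N.
have [Sol1 _] := step 0%N.
apply: CC1_Sol_pareto Sol1 _.
apply: (closed_cvg _ _ _ _ phi_p).
  apply: compact_closed; first exact: norm_hausdorff.
  exact: CC1_feasible_compact.
(* For [k >= 1], [phi k > phi 0 >= 0], so [phi k] is a successor and [feas1] applies. *)
exists 1%N => //= k k1.
by rewrite -(prednK (leq_trans (ltn0Sn _) (phi_mono _ _ k1))).
Qed.
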